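(* Fix $\delta\in(0,1)$ and $\varepsilon\in(0,1/2)$, and let $L=\lfloor N^\delta\rfloor$. Let $D$ be an $N\times N$ matrix and $\lambda$ a choice model on $S_N$ with $\|D-M(\lambda)\|_2\le\varepsilon$, where either (1) $\lambda=\mathbb P_w$ is an MNL model with parameters $0<w_1<w_2<\dots<w_N$ satisfying $\dfrac{w_N}{\sum_{k=1}^{N-L}w_k}\le\dfrac{\sqrt{\log N}}{N}$; or (2) $\lambda=\mathbb P_\theta$ is an exponential family model whose parameters satisfy, for any four distinct pairs $(i_1,j_1),(i_2,j_2),(i_3,j_3),(i_4,j_4)\in\{1,\dots,N\}^2$, $\dfrac{\exp(\theta_{i_1j_1}+\theta_{i_2j_2})}{\exp(\theta_{i_3j_3}+\theta_{i_4j_4})}\le\sqrt{\log N}$. Then, for all $N$ sufficiently large (depending on $\delta,\varepsilon$), there exists a choice model $\hat\lambda$ in the signature family with $\|D-M(\hat\lambda)\|_2\le 2\varepsilon$ and $\|\hat\lambda\|_0=O(N/\varepsilon^2)$ (one may take $\|\hat\lambda\|_0\le 4N/\varepsilon^2$).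
   Context: $S_N$ is the set of permutations of $\{1,\dots,N\}$, $\sigma(i)$ the rank of item $i$, $\sigma^{-1}(j)$ the item at rank $j$. A choice model is a probability distribution on $S_N$; $\|\lambda\|_0$ is its support size; $M_{ij}(\lambda)=\sum_\sigma\lambda(\sigma)\mathbf 1_{\{\sigma(i)=j\}}$; $\|A\|_2=(\sum_{i,j}A_{ij}^2)^{1/2}$. Signature family: $\lambda$ is in it if for every $\sigma$ in the support there is $(i,j)$ with $\sigma(i)=j$ and $\sigma'(i)\ne j$ for every other $\sigma'$ in the support. MNL model with parameters $w_1,\dots,w_N>0$: $\mathbb P_w(\sigma)=\prod_{j=1}^N\frac{w_{\sigma^{-1}(j)}}{w_{\sigma^{-1}(j)}+w_{\sigma^{-1}(j+1)}+\dots+w_{\sigma^{-1}(N)}}$. Exponential family with parameters $\theta\in\mathbb R^{N\times N}$: $\mathbb P_\theta(\sigma)=Z(\theta)^{-1}\exp(\sum_{i,j}\theta_{ij}\sigma_{ij})$, where $\sigma_{ij}=\mathbf 1_{\{\sigma(i)=j\}}$ and $Z(\theta)=\sum_{\sigma\in S_N}\exp(\sum_{i,j}\theta_{ij}\sigma_{ij})$. *)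

(* Defs.v *)
From Stdlib Require Import Reals.
From mathcomp Require Import all_boot all_fingroup.
Open Scope R_scope.
Set Implicit Arguments. Unset Strict Implicit. Unset Printing Implicit Defensive.

Notation "\Rsum_ ( i : T ) F" := (\big[Rplus/R0]_(i : T) F)
  (at level 41, F at level 41, i, T at level 50).
Notation "\Rsum_ ( i : T | P ) F" := (\big[Rplus/R0]_(i : T | P%B) F)
  (at level 41, F at level 41, i, T at level 50).
Notation "\Rprod_ ( i : T ) F" := (\big[Rmult/R1]_(i : T) F)
  (at level 41, F at level 41, i, T at level 50).

(* Items are 'I_N = {0,..,N-1} (item i of the paper is i-1 here); ranks
   likewise.  A permutation s : {perm 'I_N} maps an item to its rank:
   s i = sigma(i), and (s^-1)%g j = sigma^{-1}(j). *)

Definition Rnz (x : R) : bool := if Req_EM_T x 0 then false else true.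

Definition choice_model (N : nat) (lam : {perm 'I_N} -> R) : Prop :=
  (forall s, (0 <= lam s)) /\ \Rsum_(s : {perm 'I_N}) lam s = 1.

Definition support (N : nat) (lam : {perm 'I_N} -> R) : {set {perm 'I_N}} :=
  [set s | Rnz (lam s)].

Definition norm0 (N : nat) (lam : {perm 'I_N} -> R) : nat := #|support lam|.

Definition Mmat (N : nat) (lam : {perm 'I_N} -> R) (i j : 'I_N) : R :=
  \Rsum_(s : {perm 'I_N}) (lam s * (if s i == j then 1 else 0)).

Definition frob (N : nat) (A : 'I_N -> 'I_N -> R) : R :=
  sqrt (\Rsum_(i : 'I_N) \Rsum_(j : 'I_N) (A i j ^ 2)).

Definition mdiff (N : nat) (A B : 'I_N -> 'I_N -> R) (i j : 'I_N) : R :=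
  (A i j - B i j).

Definition signature_family (N : nat) (lam : {perm 'I_N} -> R) : Prop :=
  forall s, s \in support lam ->
    exists (i j : 'I_N), s i = j /\
      forall s', s' \in support lam -> s' <> s -> s' i <> j.

Definition mnl (N : nat) (w : 'I_N -> R) (s : {perm 'I_N}) : R :=
  \Rprod_(j : 'I_N)
    (w ((s^-1)%g j) /
     (\Rsum_(k : 'I_N | (j <= k)%N) w ((s^-1)%g k))).

Definition sig_ind (N : nat) (s : {perm 'I_N}) (i j : 'I_N) : R :=
  if s i == j then 1 else 0.

Definition expo_weight (N : nat) (theta : 'I_N -> 'I_N -> R) (s : {perm 'I_N}) : R :=
  exp (\Rsum_(i : 'I_N) \Rsum_(j : 'I_N) (theta i j * sig_ind s i j)).

Definition Zpart (N : nat) (theta : 'I_N -> 'I_N -> R) : R :=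
  \Rsum_(s : {perm 'I_N}) expo_weight theta s.

Definition expfam (N : nat) (theta : 'I_N -> 'I_N -> R) (s : {perm 'I_N}) : R :=
  (expo_weight theta s / Zpart theta).

Definition Lfloor (delta : R) (N : nat) : nat :=
  Z.to_nat (Int_part (Rpower (INR N) delta)).

(* hypothesis (1) on the MNL parameters (items 0-indexed: paper's w_k is
   w (k-1); paper's w_N is the w i with val i = N-1) *)
Definition mnl_hyp (delta : R) (N : nat) (w : 'I_N -> R) : Prop :=
  (forall i : 'I_N, (0 < w i)) /\
  (forall i j : 'I_N, (i < j)%N -> (w i < w j)) /\
  (forall iN : 'I_N, nat_of_ord iN = N.-1 ->
     (w iN / (\Rsum_(k : 'I_N | (k < N - Lfloor delta N)%N) w k)
       <= sqrt (ln (INR N)) / INR N)).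

Definition expfam_hyp (N : nat) (theta : 'I_N -> 'I_N -> R) : Prop :=
  forall p1 p2 p3 p4 : 'I_N * 'I_N,
    p1 <> p2 -> p1 <> p3 -> p1 <> p4 -> p2 <> p3 -> p2 <> p4 -> p3 <> p4 ->
    (exp (theta p1.1 p1.2 + theta p2.1 p2.2) /
     exp (theta p3.1 p3.2 + theta p4.1 p4.2) <= sqrt (ln (INR N))).

(* Main.v *)
(* Sample K = ceil(2 N / eps^2) permutations independently from lam and take
   their empirical distribution.  The expected squared Frobenius error of its
   first-order marginal matrix is at most N / K <= eps^2 / 2.

   For both models the item at rank l < L, conditionally on the items at ranks
   < l, is any given item with probability at most p = 2 sqrt(ln N) / N: for MNL
   this is the sequential description of the Plackett-Luce law, for the
   exponential family it comes from exchanging the items at ranks l and k >= l.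
   Revealing the ranks one after the other, the probability that at each of the
   ranks 0,...,L-1 a fixed sample shares its item with another sample is at most
   (1 - (1-p)^K)^L, which is o(1/K) because (1-p)^K = N^(-o(1)) and L ~ N^delta.
   Otherwise some rank witnesses the signature condition for this sample, and a
   first-moment argument yields a realisation where everything holds at once. *)
Require Import Defs.
From Stdlib Require Import Reals Lra.
From mathcomp Require Import all_boot all_fingroup.
Set Implicit Arguments. Unset Strict Implicit. Unset Printing Implicit Defensive.
Open Scope R_scope.

(** * Asymptotics *)

Lemma exp_pow_INR x n : exp x ^ n = exp (INR n * x).
Proof.
elim: n => [|n IH]; first by rewrite Rmult_0_l exp_0.
rewrite -tech_pow_Rmult IH -exp_plus S_INR; f_equal; ring.
Qed.

(** Square the tangent bound [1 + y / 2 <= exp (y / 2)]. *)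
Lemma sqr_div4_le_exp y : 0 <= y -> y ^ 2 / 4 <= exp y.
Proof.
move=> y0; have -> : y = y / 2 + y / 2 by lra.
rewrite exp_plus; have := exp_ineq1_le (y / 2); nra.
Qed.

(** For such [p], [(1 - p) (1 + 2 p) = 1 + p (1 - 2 p) >= 1], and [exp (2 p) >= 1 + 2 p]. *)
Lemma exp_double_le_1_sub p : 0 <= p <= 1 / 2 -> exp (- (2 * p)) <= 1 - p.
Proof.
move=> [p0 p1]; rewrite exp_Ropp; have e2 := exp_ineq1_le (2 * p).
apply: (Rmult_le_reg_l (exp (2 * p))); first exact: exp_pos.
rewrite Rinv_r; last by have := exp_pos (2 * p); lra.
nra.
Qed.

Lemma INR_to_nat_floor r : 1 <= r ->
  r - 1 < INR (Z.to_nat (Int_part r)) <= r.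
Proof.
move=> r1; have [lo hi] := base_Int_part r.
have z0 : (0 <= Int_part r)%Z by apply: le_IZR; lra.
rewrite INR_IZR_INZ Znat.Z2Nat.id //; lra.
Qed.

Lemma INR_to_nat_up r : 0 <= r -> r < INR (Z.to_nat (up r)) <= r + 1.
Proof.
move=> r0; have [lo hi] := archimed r.
have z0 : (0 <= up r)%Z by apply: le_IZR; lra.
rewrite INR_IZR_INZ Znat.Z2Nat.id //; lra.
Qed.

(* Here [x = ln N]: one has [(1 - p)^k >= N^(-delta/2)], so the left-hand side is
   at most [k exp (1 - N^(delta/2)) <= (4 / eps^2) exp (1 - x)]. *)
Lemma collision_bound (delta eps x p : R) (k l : nat) :
  0 < delta < 1 -> 0 < eps < 1 / 2 ->
  16 <= x -> (32 / (delta * eps ^ 2)) ^ 2 <= x -> 32 / delta ^ 2 <= x -> 1 + 8 / eps ^ 2 <= x ->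
  0 <= p <= 1 / 2 -> p = 2 * sqrt x / exp x -> INR k <= 4 * exp x / eps ^ 2 ->
  exp (delta * x) - 1 <= INR l ->
  INR k * (1 - (1 - p) ^ k) ^ l < 1 / 2.
Proof.
move=> [d0 d1] [e0 e1] x16 xb xc xd [p0 p1] pE kN lN.
have e20 : 0 < eps ^ 2 by nra.
have ex0 := exp_pos x.
have s0 := sqrt_pos x.
have sx : sqrt x * sqrt x = x by apply: sqrt_sqrt; lra.
have xs : 32 / (delta * eps ^ 2) <= sqrt x.
  rewrite -(sqrt_pow2 (32 / _)); first exact: sqrt_le_1_alt.
  by apply: Rlt_le; apply: Rdiv_lt_0_compat; nra.
(* The left side is at most [16 sqrt x / eps^2], and [sqrt x] is at least [32 / (delta eps^2)]. *)
have pk : 2 * p * INR k <= delta * x / 2.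
  apply: (Rle_trans _ (2 * p * (4 * exp x / eps ^ 2))); first by apply: Rmult_le_compat_l; lra.
  rewrite pE.
  have -> : 2 * (2 * sqrt x / exp x) * (4 * exp x / eps ^ 2)
      = (32 / (delta * eps ^ 2)) * (delta * sqrt x / 2).
    by field; nra.
  rewrite -{2}sx; apply: (Rle_trans _ (sqrt x * (delta * sqrt x / 2))); last lra.
  by apply: Rmult_le_compat_r => //; nra.
set u := exp (- (delta * x / 2)).
have u0 : 0 < u by exact: exp_pos.
have u1 : u <= 1.
  by rewrite -exp_0 /u; apply: Rlt_le; apply: exp_increasing; nra.
have uk : u <= (1 - p) ^ k.
  apply: (Rle_trans _ (exp (- (2 * p)) ^ k)).
    rewrite exp_pow_INR /u; have : - (delta * x / 2) <= INR k * - (2 * p) by nra.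
    by case=> [lt|->]; [apply/Rlt_le/exp_increasing | right].
  by apply: pow_incr; split; [apply/Rlt_le/exp_pos | apply: exp_double_le_1_sub].
have pk1 : (1 - p) ^ k <= 1.
  by have := pow_incr (1 - p) 1 k; rewrite pow1; lra.
have ql : (1 - (1 - p) ^ k) ^ l <= exp (- (INR l * u)).
  apply: (Rle_trans _ (exp (- u) ^ l)).
    by apply: pow_incr; split; first lra; have := exp_ineq1_le (- u); lra.
  by rewrite exp_pow_INR; right; congr exp; ring.
(* As [u <= 1], the right side is at least [exp (delta x / 2) - 1]; the quadratic bound and
   [delta^2 x >= 32] do the rest. Having [2 x] and not [x] leaves a factor [exp (- x)] to spare once
   [k], of order [exp x], is multiplied in. *)
have ul : 2 * x - 1 <= INR l * u.
  have uu : exp (delta * x) * u = exp (delta * x / 2) by rewrite -exp_plus; congr exp; field.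
  have y4 : (delta * x / 2) ^ 2 / 4 <= exp (delta * x / 2) by apply: sqr_div4_le_exp; nra.
  have dx : 32 <= delta ^ 2 * x.
    have -> : 32 = delta ^ 2 * (32 / delta ^ 2) by field; lra.
    by apply: Rmult_le_compat_l; nra.
  have : 2 * x <= (delta * x / 2) ^ 2 / 4 by nra.
  nra.
have ql2 : (1 - (1 - p) ^ k) ^ l <= exp (1 - 2 * x).
  apply: Rle_trans ql _; have : - (INR l * u) <= 1 - 2 * x by lra.
  by case=> [lt|->]; [apply/Rlt_le/exp_increasing | right].
apply: (Rle_lt_trans _ (4 * exp x / eps ^ 2 * exp (1 - 2 * x))).
  by apply: Rmult_le_compat => //; [exact: pos_INR | apply: pow_le; lra].
have -> : 4 * exp x / eps ^ 2 * exp (1 - 2 * x) = 4 / eps ^ 2 * exp (- (x - 1)).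
  have -> : - (x - 1) = x + (1 - 2 * x) by ring.
  by rewrite exp_plus; field; lra.
rewrite exp_Ropp; have e8 : 8 / eps ^ 2 < exp (x - 1) by have := exp_ineq1_le (x - 1); lra.
have ep := exp_pos (x - 1).
apply: (Rmult_lt_reg_r (exp (x - 1))) => //.
rewrite Rmult_assoc Rinv_l; last lra.
lra.
Qed.

Lemma asymptotics (delta eps : R) : 0 < delta < 1 -> 0 < eps < 1 / 2 ->
  exists N0 : nat, forall N : nat, (N0 <= N)%N ->
  [/\ (0 < Lfloor delta N)%N, (2 * Lfloor delta N <= N)%N & 1 <= sqrt (ln (INR N))] /\
  0 < 2 * sqrt (ln (INR N)) / INR N <= 1 /\
  exists K : nat, [/\ 2 * INR N <= INR K * eps ^ 2, INR K <= 4 * INR N / eps ^ 2 &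
    INR K * (1 - (1 - 2 * sqrt (ln (INR N)) / INR N) ^ K) ^ Lfloor delta N < 1 / 2].
Proof.
move=> dP eP; have [d0 d1] := dP; have [e0 e1] := eP.
have e20 : 0 < eps ^ 2 by nra.
(* A sum of nonnegative thresholds, so [ln N > X0] exceeds each of them. The last one gives
   [N^(1 - delta) >= 2], hence [2 L <= N]. *)
pose X0 := 16 + (32 / (delta * eps ^ 2)) ^ 2 + 32 / delta ^ 2 + (1 + 8 / eps ^ 2) + 1 / (1 - delta).
have b1 : 0 <= (32 / (delta * eps ^ 2)) ^ 2 by apply: pow2_ge_0.
have b2 : 0 < 32 / delta ^ 2 by apply: Rdiv_lt_0_compat; nra.
have b3 : 0 < 8 / eps ^ 2 by apply: Rdiv_lt_0_compat; lra.
have b4 : 0 < 1 / (1 - delta) by apply: Rdiv_lt_0_compat; lra.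
exists (Z.to_nat (up (exp X0))) => N /leP/le_INR N0N.
have [N0lo _] := INR_to_nat_up (Rlt_le _ _ (exp_pos X0)).
have NX0 : exp X0 < INR N by lra.
have Npos : 0 < INR N by have := exp_pos X0; lra.
set x := ln (INR N).
have xX0 : X0 < x by rewrite -(ln_exp X0) /x; apply: ln_increasing => //; exact: exp_pos.
have Nx : exp x = INR N by exact: exp_ln.
have x16 : 16 <= x by rewrite /X0 in xX0; lra.
have sx : sqrt x * sqrt x = x by apply: sqrt_sqrt; lra.
have s1 : 1 <= sqrt x by rewrite -sqrt_1; apply: sqrt_le_1_alt; lra.
have dx0 : 0 <= delta * x by nra.
have dx1 : 1 <= exp (delta * x) by have := exp_ineq1_le (delta * x); lra.
have [Llo Lhi] := INR_to_nat_floor dx1.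
have LE : Lfloor delta N = Z.to_nat (Int_part (exp (delta * x))) by [].
rewrite -LE in Llo Lhi.
have p0 : 0 < 2 * sqrt x / INR N by apply: Rdiv_lt_0_compat; lra.
have p1 : 2 * sqrt x / INR N <= 1 / 2.
  apply: (Rmult_le_reg_r (INR N)) => //; rewrite /Rdiv Rmult_assoc Rinv_l; last lra.
  have : x ^ 2 / 4 <= exp x by apply: sqr_div4_le_exp; lra.
  rewrite Nx; nra.
split; first split=> //.
- by apply/ltP/INR_lt; rewrite [INR 0]/=; lra.
- apply/leP/INR_le; rewrite mult_INR [INR 2]/= -Nx.
  have -> : exp x = exp (delta * x) * exp ((1 - delta) * x) by rewrite -exp_plus; congr exp; ring.
  have : 1 <= (1 - delta) * x.
    have dE : (1 - delta) * (1 / (1 - delta)) = 1 by field; lra.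
    by rewrite -[X in X <= _]dE; apply: Rmult_le_compat_l; rewrite /X0 in xX0; lra.
  have := exp_ineq1_le ((1 - delta) * x); nra.
split; first lra.
have t0 : 0 <= 2 * INR N / eps ^ 2 by apply/Rlt_le/Rdiv_lt_0_compat; lra.
have [Klo Khi] := INR_to_nat_up t0.
(* [up] overshoots by at most 1, which is absorbed in the upper bound because [2 N / eps^2 >= 1]. *)
exists (Z.to_nat (up (2 * INR N / eps ^ 2))).
have NE : 2 * INR N / eps ^ 2 * eps ^ 2 = 2 * INR N by field; lra.
have KN : INR (Z.to_nat (up (2 * INR N / eps ^ 2))) <= 4 * INR N / eps ^ 2.
  have : 1 <= 2 * INR N / eps ^ 2.
    apply: (Rmult_le_reg_r (eps ^ 2)) => //; rewrite NE Rmult_1_l.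
    have : x ^ 2 / 4 <= exp x by apply: sqr_div4_le_exp; lra.
    rewrite Nx; nra.
  lra.
split=> //; first by nra.
apply: (@collision_bound delta eps x) => //; try (rewrite /X0 in xX0; lra).
- by rewrite Nx.
- by rewrite Nx.
Qed.

From mathcomp Require Import all_order all_algebra Rstruct lra ring.
Import Order.TTheory GRing.Theory Num.Theory.
Local Open Scope ring_scope.

(** * Independent samples *)

(* Given the classes [h (t i)], the coordinates are independent and each of
   those in [A] misses [E] with probability at least [1 - p]. *)
Lemma exposure_step (R : realFieldType) (I X Y : finType) (mu : I -> X -> R)
  (A : pred I) (p : R) (h : X -> Y) (E : pred X) (B : pred {ffun I -> X}) :
  (forall i x, 0 <= mu i x) -> p <= 1 ->
  (forall i y, A i ->
     \sum_(x | (h x == y) && E x) mu i x <= p * \sum_(x | h x == y) mu i x) ->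
  (forall t t' : {ffun I -> X}, (forall i, h (t i) = h (t' i)) -> B t = B t') ->
  \sum_(t : {ffun I -> X} | B t && [exists i, A i && E (t i)]) \prod_i mu i (t i)
  <= (1 - (1 - p) ^+ #|A|) * \sum_(t : {ffun I -> X} | B t) \prod_i mu i (t i).
Proof.
move=> mu0 p1 condE Bh.
pose w (t : {ffun I -> X}) := \prod_i mu i (t i).
pose miss (t : {ffun I -> X}) := [forall i, A i ==> ~~ E (t i)].
have missE (t : {ffun I -> X}) : ~~ [exists i, A i && E (t i)] = miss t.
  by rewrite negb_exists; apply: eq_forallb => i; rewrite negb_and implybE.
have splitB : \sum_(t | B t) w t = \sum_(t | B t && [exists i, A i && E (t i)]) w t
    + \sum_(t | B t && miss t) w t.
  rewrite (bigID (fun t : {ffun I -> X} => [exists i, A i && E (t i)]) B) /=.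
  by congr (_ + _); apply: eq_bigl => t; rewrite missE.
(* The complementary event [miss] is a condition on each coordinate separately, so it is compatible
   with products. *)
suff : (1 - p) ^+ #|A| * \sum_(t | B t) w t <= \sum_(t | B t && miss t) w t.
  rewrite -/(\sum_(t | B t && [exists i, A i && E (t i)]) w t) -/(\sum_(t | B t) w t).
  by rewrite mulrBl mul1r {2}splitB lerBrDr lerD2l.
pose H (t : {ffun I -> X}) := [ffun i => h (t i)].
rewrite (partition_big H predT) //= [leRHS](partition_big H predT) //=.
rewrite mulr_sumr; apply: ler_sum => c _.
have [t0 /andP[Bt0 /eqP Ht0]|noB] := pickP (fun t : {ffun I -> X} => B t && (H t == c)); last first.
  rewrite (big_pred0 _ _ _ _ noB) mulr0 big_pred0 // => t.
  by rewrite andbAC [B t && _]noB.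
have BH (t : {ffun I -> X}) : H t == c -> B t.
  move=> /eqP Ht; rewrite (Bh t t0) // => i.
  by have /ffunP/(_ i) := Ht; rewrite -Ht0 !ffunE.
have HE (t : {ffun I -> X}) : (H t == c) = [forall i, h (t i) == c i].
  apply/eqP/forallP => [<- i|Ht]; first by rewrite ffunE.
  by apply/ffunP => i; rewrite ffunE; apply/eqP.
(* For a fixed vector of classes [c], both sets of samples are boxes; the two sums factor and can be
   compared coordinate by coordinate. *)
rewrite (eq_bigl (fun t => t \in family (fun i => [pred x | h x == c i]))); last first.
  by move=> t; rewrite -[RHS]/[forall i, h (t i) == c i] -HE andb_idl //; apply: BH.
rewrite [leRHS](eq_bigl (fun t => t \in family
    (fun i => [pred x | (h x == c i) && (A i ==> ~~ E x)]))); last first.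
  move=> t; rewrite -[RHS]/[forall i, (h (t i) == c i) && (A i ==> ~~ E (t i))].
  apply/andP/forallP => [[/andP[_ mt]]|Ht].
    by rewrite HE => /forallP Ht i; rewrite Ht; apply: (forallP mt).
  have Hc : H t == c by rewrite HE; apply/forallP => i; have /andP[] := Ht i.
  by rewrite BH //; split=> //; apply/forallP => i; have /andP[] := Ht i.
rewrite -!bigA_distr_big_dep.
rewrite -[in X in X * _]prodr_const.
rewrite [in X in X * _](big_mkcond A) /= -big_split /=.
apply: ler_prod => i _; apply/andP; split.
  by rewrite mulr_ge0 ?sumr_ge0 //; case: ifP => // _; rewrite subr_ge0.
have [Ai|nAi] := ifP; last first.
  rewrite mul1r le_eqVlt; apply/orP; left; apply/eqP/eq_bigl => x.
  by rewrite -[RHS]/((h x == c i) && true) andbT.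
have -> : \sum_(x | h x == c i) mu i x
    = \sum_(x | (h x == c i) && E x) mu i x + \sum_(x | (h x == c i) && ~~ E x) mu i x.
  exact: bigID.
rewrite [leRHS](eq_bigl (fun x => (h x == c i) && ~~ E x)) //.
have := condE i (c i) Ai; rewrite [X in _ * X](bigID E) /=.
by set a := \sum_(x | _ && E x) _; set b := \sum_(x | _) _; lra.
Qed.

(** Induction on [L]: the class [h L] determines all earlier events, so their conjunction can be the
    [B] of [exposure_step], and each rank contributes one factor. The weights need not be
    normalised, whence the product of totals. *)
Lemma exposure (R : realFieldType) (I X Y : finType) (mu : I -> X -> R)
  (A : pred I) (p : R) (h : nat -> X -> Y) (E : nat -> pred X) (L : nat) :
  (forall i x, 0 <= mu i x) -> 0 <= p <= 1 ->
  (forall l i y, (l < L)%N -> A i ->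
     \sum_(x | (h l x == y) && E l x) mu i x <= p * \sum_(x | h l x == y) mu i x) ->
  (forall j l x x', (j < l)%N -> (l < L)%N -> h l x = h l x' -> E j x = E j x') ->
  \sum_(t : {ffun I -> X} | [forall j : 'I_L, [exists i, A i && E j (t i)]])
     \prod_i mu i (t i)
  <= (1 - (1 - p) ^+ #|A|) ^+ L * \prod_i \sum_x mu i x.
Proof.
move=> mu0 /andP[p0 p1]; elim: L => [|L IH] condE detE.
  rewrite expr0 mul1r bigA_distr_bigA (eq_bigl predT) //.
  by move=> t; apply/forallP => -[].
rewrite exprS -mulrA.
apply: (@le_trans _ _ ((1 - (1 - p) ^+ #|A|) *
  \sum_(t : {ffun I -> X} | [forall j : 'I_L, [exists i, A i && E j (t i)]])
     \prod_i mu i (t i))); last first.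
  apply: ler_wpM2l.
    rewrite subr_ge0 exprn_ile1 ?subr_ge0 //; lra.
  apply: IH => [l i y lL|j l x x' jl lL]; first exact/condE/ltnW.
  exact/detE/ltnW.
rewrite (eq_bigl (fun t : {ffun I -> X} => [forall j : 'I_L, [exists i, A i && E j (t i)]]
    && [exists i, A i && E L (t i)])); last first.
  move=> t; apply/forallP/andP => [Ht|[/forallP Ht HL] j].
    split; last exact: (Ht ord_max).
    by apply/forallP => j; have := Ht (widen_ord (leqnSn L) j).
  have := ltn_ord j; rewrite ltnS leq_eqVlt => /orP[/eqP -> //|jL].
  exact: (Ht (Ordinal jL)).
apply: (exposure_step mu0 p1 (h := h L)) => [i y Ai|t t' tt'].
  exact: condE.
apply: eq_forallb => j; apply: eq_existsb => i.
by rewrite (detE j L (t i) (t' i)).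
Qed.

Lemma iid_total (R : realFieldType) (I X : finType) (lam : X -> R) :
  \sum_x lam x = 1 -> \sum_(t : {ffun I -> X}) \prod_i lam (t i) = 1.
Proof. by move=> lam1; rewrite -(bigA_distr_bigA (fun _ : I => lam)) big1 // => i _. Qed.

(** The sum factors over coordinates. If [i] and [j] differ, the factor at [i] is the mean of [g],
    which is 0; if they coincide, both copies of [g] meet in one factor. *)
Lemma iid_covariance (R : realFieldType) (I X : finType) (lam : X -> R)
    (g : X -> R) (i j : I) :
  \sum_x lam x = 1 -> \sum_x lam x * g x = 0 ->
  \sum_(t : {ffun I -> X}) (\prod_k lam (t k)) * (g (t i) * g (t j))
  = if i == j then \sum_x lam x * g x ^+ 2 else 0.
Proof.
move=> lam1 g0.
pose F k x := lam x * ((if k == i then g x else 1) * (if k == j then g x else 1)).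
transitivity (\prod_k \sum_x F k x).
  rewrite bigA_distr_bigA; apply: eq_bigr => t _; rewrite !big_split /=.
  by rewrite -!big_mkcond !big_pred1_eq.
rewrite (bigD1 i) //=; have [eij|ij] := eqVneq i j.
  subst j; rewrite [X in _ * X]big1 => [|k /negPf ki]; last first.
    by rewrite -[RHS]lam1; apply: eq_bigr => x _; rewrite /F ki !mulr1.
  by rewrite mulr1; apply: eq_bigr => x _; rewrite /F eqxx expr2.
rewrite (_ : \sum_x F i x = 0) ?mul0r // -[RHS]g0.
by apply: eq_bigr => x _; rewrite /F eqxx (negPf ij) mulr1.
Qed.

Lemma iid_variance (R : realFieldType) (I X : finType) (lam : X -> R) (g : X -> R) :
  \sum_x lam x = 1 -> \sum_x lam x * g x = 0 ->
  \sum_(t : {ffun I -> X}) (\prod_k lam (t k)) * (\sum_i g (t i)) ^+ 2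
  = #|I|%:R * \sum_x lam x * g x ^+ 2.
Proof.
move=> lam1 g0.
transitivity (\sum_i \sum_j \sum_(t : {ffun I -> X})
    (\prod_k lam (t k)) * (g (t i) * g (t j))).
  under [RHS]eq_bigr do rewrite exchange_big /=.
  rewrite exchange_big; apply: eq_bigr => t _ /=.
  rewrite expr2 mulr_suml mulr_sumr; apply: eq_bigr => i _.
  by rewrite mulr_sumr mulr_sumr.
under eq_bigr do under eq_bigr do rewrite iid_covariance //.
under eq_bigr do rewrite -big_mkcond (big_pred1 _ (fun=> eq_sym _ _)) /=.
by rewrite sumr_const mulr_natl.
Qed.

(** Once the value [s] of sample [k] is fixed, the others remain independent and the events [E s]
    are fixed, so [exposure] applies to the other [#|I|.-1] coordinates. Averaging over [s] costs
    nothing, since [lam] has mass 1. *)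
Lemma iid_collision (R : realFieldType) (I X Y : finType) (lam : X -> R) (k : I)
    (p : R) (h : nat -> X -> Y) (E : X -> nat -> pred X) (L : nat) :
  (forall x, 0 <= lam x) -> \sum_x lam x = 1 -> 0 <= p <= 1 ->
  (forall s l y, (l < L)%N ->
     \sum_(x | (h l x == y) && E s l x) lam x <= p * \sum_(x | h l x == y) lam x) ->
  (forall s j l x x', (j < l)%N -> (l < L)%N -> h l x = h l x' -> E s j x = E s j x') ->
  \sum_(t : {ffun I -> X} | [forall j : 'I_L, [exists i, (i != k) && E (t k) j (t i)]])
     \prod_i lam (t i)
  <= (1 - (1 - p) ^+ #|I|.-1) ^+ L.
Proof.
move=> lam0 lam1 p01 condE detE.
(* The weights [mu s] pin the k-th coordinate to [s]. *)
pose mu s i x := lam x * (if i == k then (x == s)%:R else 1).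
have mu_tot s : \prod_i \sum_x mu s i x = lam s.
  rewrite (bigD1 k) //= [X in _ * X]big1 => [|i /negPf ik]; last first.
    by rewrite -[RHS]lam1; apply: eq_bigr => x _; rewrite /mu ik mulr1.
  rewrite mulr1 (bigD1 s) //= /mu !eqxx mulr1 big1 ?addr0 // => x /negPf ->.
  by rewrite mulr0.
rewrite (partition_big (fun t : {ffun I -> X} => t k) predT) //=.
rewrite -[leRHS]mulr1 -[X in _ <= _ * X]lam1 mulr_sumr; apply: ler_sum => s _.
rewrite -mu_tot.
have -> : #|I|.-1 = #|predC1 k| by rewrite cardC1.
apply: (le_trans _ (exposure (mu := mu s) (h := h) (E := E s) (A := predC1 k) _ p01 _ _)).
- rewrite big_mkcond [leRHS]big_mkcond; apply: ler_sum => t _.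
  have P0 : 0 <= \prod_i mu s i (t i).
    by apply: prodr_ge0 => i _; rewrite /mu mulr_ge0 //; case: ifP.
  case: ifP => [/andP[Et /eqP tk]|_]; last by case: ifP.
  rewrite -tk Et (eq_bigr (fun i => mu (t k) i (t i))) // => i _.
  by rewrite /mu; have [->|] := eqVneq i k; rewrite ?eqxx mulr1.
- by move=> i x; rewrite /mu mulr_ge0 //; case: ifP.
- move=> l i y lL /negPf ik; rewrite /mu ik.
  by under eq_bigr do rewrite mulr1; under [X in _ * X]eq_bigr do rewrite mulr1; apply: condE.
- exact: detE.
Qed.

(** Markov's inequality for the squared deviation and a union bound over the samples [k], merged
    into a single expectation. *)
Lemma iid_good_sample (R : realFieldType) (I X Y F : finType) (lam : X -> R)
    (g : F -> X -> R) (p V a : R) (h : nat -> X -> Y) (E : X -> nat -> pred X) (L : nat) :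
  (forall x, 0 <= lam x) -> \sum_x lam x = 1 -> 0 <= p <= 1 ->
  (forall s l y, (l < L)%N ->
     \sum_(x | (h l x == y) && E s l x) lam x <= p * \sum_(x | h l x == y) lam x) ->
  (forall s j l x x', (j < l)%N -> (l < L)%N -> h l x = h l x' -> E s j x = E s j x') ->
  (forall f, \sum_x lam x * g f x = 0) ->
  \sum_f \sum_x lam x * g f x ^+ 2 <= V -> 0 < a ->
  #|I|%:R * V / a + #|I|%:R * (1 - (1 - p) ^+ #|I|.-1) ^+ L < 1 ->
  exists t : {ffun I -> X},
    \sum_f (\sum_i g f (t i)) ^+ 2 <= a /\
    forall k, exists j : 'I_L, forall i, i != k -> ~~ E (t k) j (t i).
Proof.
move=> lam0 lam1 p01 condE detE g0 gV a0 lt1.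
pose Q (t : {ffun I -> X}) := \sum_f (\sum_i g f (t i)) ^+ 2.
pose bad (t : {ffun I -> X}) k := [forall j : 'I_L, [exists i, (i != k) && E (t k) j (t i)]].
pose w (t : {ffun I -> X}) := \prod_i lam (t i).
have Q0 t : 0 <= Q t by apply: sumr_ge0 => f _; exact: sqr_ge0.
have w0 t : 0 <= w t by exact: prodr_ge0.
(* First-moment method: a sample of cost below 1 is good, and the mean cost is
   below 1. *)
pose cost t : R := Q t / a + \sum_k (bad t k)%:R.
have mean : \sum_t w t * cost t < \sum_t w t * 1.
  under [ltRHS]eq_bigr do rewrite mulr1; rewrite iid_total //.
  apply: le_lt_trans lt1; under eq_bigr do rewrite mulrDr.
  rewrite big_split /=; apply: lerD.
    under eq_bigr do rewrite mulrA.
    rewrite -mulr_suml ler_pM2r ?invr_gt0 //.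
    under eq_bigr do rewrite mulr_sumr.
    rewrite exchange_big /=; under eq_bigr do rewrite iid_variance //.
    by rewrite -mulr_sumr ler_wpM2l ?ler0n.
  under eq_bigr do rewrite mulr_sumr.
  rewrite exchange_big /= -[X in X * _]sumr_const mulr_suml; apply: ler_sum => k _.
  rewrite mul1r; apply: (le_trans _ (iid_collision k lam0 lam1 p01 condE detE)).
  rewrite [leRHS]big_mkcond; apply: ler_sum => t _.
  by rewrite -/(bad t k) /w; case: (bad t k); rewrite ?mulr1 ?mulr0.
have [t Ht|no] := pickP (fun t => cost t < 1).
  exists t; have S0 : 0 <= \sum_k (bad t k)%:R :> R by apply: sumr_ge0 => k _; exact: ler0n.
  have Qa0 : 0 <= Q t / a by rewrite divr_ge0 // ltW.
  split.
    by have : Q t / a <= 1 by [move: Ht; rewrite /cost; lra]; rewrite ler_pdivrMr ?mul1r.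
  move=> k; have : ~~ bad t k.
    apply: contraTN Ht => bk; rewrite -leNgt /cost (bigD1 k) //= bk.
    have : 0 <= \sum_(i | i != k) (bad t i)%:R :> R by apply: sumr_ge0 => i _; exact: ler0n.
    by rewrite /=; lra.
  rewrite negb_forall => /existsP[j]; rewrite negb_exists => /forallP Hj; exists j => i ik.
  by have := Hj i; rewrite ik.
exfalso; move: mean; rewrite ltNge => /negP; apply; apply: ler_sum => t _.
by rewrite ler_wpM2l // leNgt no.
Qed.

(** * Conditional law of the item at a given rank *)

(** The history before rank [l], recorded item by item; [None] marks an item not yet placed. It
    serves as the class map [h l] of the sampling lemmas. *)
Definition top_ranks N (l : nat) (s : {perm 'I_N}) : {ffun 'I_N -> option 'I_N} :=
  [ffun i => if (s i < l)%N then Some (s i) else None].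

(** The collision event at rank [l]. The existential over the common item lets [l] be any natural
    number, as the events [E] of the sampling lemmas require. *)
Definition agree_at N (s : {perm 'I_N}) (l : nat) : pred {perm 'I_N} :=
  fun s' => [exists i, (s i == l :> nat) && (s' i == s i)].

Lemma top_ranksP N l (s s' : {perm 'I_N}) :
  reflect (forall i, (s i < l)%N || (s' i < l)%N -> s i = s' i)
    (top_ranks l s == top_ranks l s').
Proof.
apply: (iffP eqP) => [eq_ss' i|eq_ss'].
  by have /ffunP/(_ i) := eq_ss'; rewrite !ffunE; do 2!case: ifP => // _; case.
apply/ffunP => i; rewrite !ffunE.
have [ltl|] := boolP ((s i < l)%N || (s' i < l)%N); first by rewrite eq_ss'.
by rewrite negb_or => /andP[/negPf-> /negPf->].
Qed.

Lemma top_ranks_ltn N l (s s' : {perm 'I_N}) i :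
  top_ranks l s = top_ranks l s' -> (s i < l)%N = (s' i < l)%N.
Proof. by move=> /ffunP/(_ i); rewrite !ffunE; do 2!case: ifP. Qed.

Lemma agree_at_top_ranks N (s x x' : {perm 'I_N}) (j l : nat) :
  (j < l)%N -> top_ranks l x = top_ranks l x' -> agree_at s j x = agree_at s j x'.
Proof.
move=> jl /eqP/top_ranksP xx'; apply: eq_existsb => i.
have [sij|] //= := eqVneq (s i : nat) j.
apply/eqP/eqP => xi; [rewrite -xx' // xi | rewrite xx' // xi]; by rewrite sij jl ?orbT.
Qed.

Lemma agree_atE N (s s' : {perm 'I_N}) (l : 'I_N) :
  agree_at s l s' = (s' ((s^-1)%g l) == l).
Proof.
apply/existsP/eqP => [[i /andP[/eqP/val_inj <- /eqP s'i]]|s'l]; first by rewrite permK.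
by exists ((s^-1)%g l); rewrite permKV s'l !eqxx.
Qed.

Lemma top_ranks_swap N (l k : 'I_N) (s : {perm 'I_N}) :
  (l <= k)%N -> top_ranks l (s * tperm l k)%g = top_ranks l s.
Proof.
move=> lk; apply/eqP/top_ranksP => i; rewrite permM.
by case: tpermP => [->|->|//]; rewrite ltnn /= ltnNge lk.
Qed.

Lemma card_ord_ltn N M : (M <= N)%N -> #|[pred k : 'I_N | (k < M)%N]| = M.
Proof.
by move=> MN; rewrite -sum1_card -(big_ord_widen N (fun=> 1%N) MN) sum1_card card_ord.
Qed.

Lemma card_ord_geq N M : (M <= N)%N -> #|[pred k : 'I_N | (M <= k)%N]| = (N - M)%N.
Proof.
move=> MN; apply: (@addnI M); rewrite subnKC // -[RHS]card_ord.
rewrite -(cardC [pred k : 'I_N | (k < M)%N]) card_ord_ltn //.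
by congr (_ + _)%N; apply: eq_card => k; rewrite !inE leqNgt.
Qed.

(* Exchanging the items at ranks [l] and [k >= l] keeps the ranks below [l] and
   turns the event [s v = l] into [s v = k]; these events are disjoint. *)
Lemma swap_conditional_bound (R : realFieldType) N (lam : {perm 'I_N} -> R) (c : R)
    (l v : 'I_N) y :
  (forall s, 0 <= lam s) -> 0 <= c ->
  (forall s j k, lam s <= c * lam (s * tperm j k)%g) ->
  (N - l)%:R * \sum_(s | (top_ranks l s == y) && (s v == l)) lam s
  <= c * \sum_(s | top_ranks l s == y) lam s.
Proof.
move=> lam0 c0 swap.
set S := \sum_(s | _ && _) _.
have S_le (k : 'I_N) : (l <= k)%N ->
    S <= c * \sum_(s | (top_ranks l s == y) && (s v == k)) lam s.
  move=> lk; rewrite /S mulr_sumr [leRHS](reindex_inj (mulIg (tperm l k))) /=.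
  rewrite [leRHS](eq_bigl (fun s : {perm 'I_N} => (top_ranks l s == y) && (s v == l))).
    by apply: ler_sum.
  move=> s; rewrite top_ranks_swap // permM; congr (_ && _).
  by rewrite -(inj_eq (@perm_inj _ (tperm l k))) tpermK tpermR.
(* One copy of [S] is charged to each rank [k >= l]; the events [s v = k] partition the class. *)
have -> : (N - l)%N = #|[pred k : 'I_N | (l <= k)%N]|.
  by rewrite card_ord_geq // ltnW.
rewrite mulr_natl -sumr_const.
rewrite [X in _ <= _ * X](partition_big (fun s : {perm 'I_N} => s v) predT) //= mulr_sumr.
rewrite [leLHS]big_mkcond; apply: ler_sum => k _; case: ifP => lk; first exact: S_le.
by rewrite mulr_ge0 // sumr_ge0.
Qed.

(* Compare [\sum (w k - c)] over the two sets, where [c] is the threshold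
   weight [w M]. *)
Lemma sum_smallest_le (R : realFieldType) N (w : 'I_N -> R) (A : pred 'I_N) (M : nat) :
  (forall i, 0 <= w i) -> (forall i j : 'I_N, (i <= j)%N -> w i <= w j) ->
  (M < N)%N -> (M <= #|A|)%N -> \sum_(k : 'I_N | (k < M)%N) w k <= \sum_(k | A k) w k.
Proof.
move=> w0 wle MN MA; pose c := w (Ordinal MN).
have : \sum_(k : 'I_N | (k < M)%N) (w k - c) <= \sum_(k | A k) (w k - c).
  rewrite big_mkcond [leRHS]big_mkcond; apply: ler_sum => k _.
  case: ifP => kM; case: ifP => // _; last by rewrite subr_ge0 wle //= leqNgt kM.
  by rewrite subr_le0 wle // ltnW.
rewrite !sumrB !sumr_const.
have : c *+ #|[pred k : 'I_N | (k < M)%N]| <= c *+ #|A|.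
  rewrite -!(mulr_natl c) ler_wpM2r ?w0 // ler_nat; apply: leq_trans MA.
  by rewrite card_ord_ltn // ltnW.
rewrite -[#|fun i => _|]/(#|[pred k : 'I_N | (k < M)%N]|) -[#|fun i => A i|]/(#|A|); lra.
Qed.

(** * The Plackett-Luce law, drawn rank by rank *)

Section PlackettLuce.
Variables (R : realFieldType) (N : nat) (w : 'I_N -> R).
Hypothesis w_gt0 : forall i, 0 < w i.
Implicit Types (s : {perm 'I_N}) (j l v : 'I_N).

(** The MNL denominator, indexed by items rather than ranks so that it visibly depends only on the
    history before [l]. *)
Definition tail_mass (l : nat) s : R := \sum_(i | (l <= s i)%N) w i.
Definition pl_factor j s : R := w ((s^-1)%g j) / tail_mass j s.
Definition pl_weight s : R := \prod_j pl_factor j s.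

Lemma tail_mass_gt0 j s : 0 < tail_mass j s.
Proof.
rewrite /tail_mass (bigD1 ((s^-1)%g j)) ?permKV //=.
by rewrite ltr_wpDr // sumr_ge0 // => i _; exact: ltW.
Qed.

Lemma pl_factor_ge0 j s : 0 <= pl_factor j s.
Proof. by rewrite divr_ge0 // ltW // tail_mass_gt0. Qed.

Lemma tail_mass_top_ranks (j l : nat) s s' : (j <= l)%N ->
  top_ranks l s = top_ranks l s' -> tail_mass j s = tail_mass j s'.
Proof.
move=> jl ss'; apply: eq_bigl => i.
have := top_ranks_ltn i ss'; have /eqP/top_ranksP/(_ i) := ss'.
case: ltnP => [_ -> // |lsi _]; case: ltnP => // ls'i _.
by rewrite !(leq_trans jl).
Qed.

Lemma pl_factor_top_ranks j (l : nat) s s' : (j < l)%N ->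
  top_ranks l s = top_ranks l s' -> pl_factor j s = pl_factor j s'.
Proof.
move=> jl ss'; rewrite /pl_factor (tail_mass_top_ranks (ltnW jl) ss').
congr (w _ / _); apply: (@perm_inj _ s'); rewrite permKV.
by have /eqP/top_ranksP <- := ss'; rewrite permKV ?jl.
Qed.

(** Turns the event that [v] comes next into a history class one rank longer, to which an inductive
    hypothesis applies. *)
Lemma top_ranks_next l v s s1 : s1 v = l ->
  ((top_ranks l s == top_ranks l s1) && (s v == l))
  = (top_ranks l.+1 s == top_ranks l.+1 s1).
Proof.
move=> s1v; apply/andP/top_ranksP => [[/top_ranksP ss1 /eqP sv] i|ss1]; last first.
  split; last by rewrite ss1 s1v // ltnSn orbT.
  by apply/top_ranksP => i /orP[] si; apply: ss1; rewrite !ltnS (ltnW si) ?orbT.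
case: (ltngtP (s i) l) => [si _|si|/val_inj si _]; first by apply: ss1; rewrite si.
  case: (ltngtP (s1 i) l) => [si1 _|si1|/val_inj si1 _]; first by apply: ss1; rewrite si1 orbT.
    by rewrite !ltnS leqNgt si leqNgt si1.
  by rewrite -s1v in si1; rewrite (perm_inj si1) sv s1v.
by rewrite -sv in si; rewrite (perm_inj si) sv s1v.
Qed.

Lemma top_ranks_next_empty l v s s0 : (s0 v < l)%N ->
  ((top_ranks l s == top_ranks l s0) && (s v == l)) = false.
Proof.
move=> vl; apply/negP => /andP[/top_ranksP/(_ v)]; rewrite vl orbT => /(_ isT) -> /eqP sl.
by move: vl; rewrite sl ltnn.
Qed.

Lemma top_ranks_all s s0 : (top_ranks N s == top_ranks N s0) = (s == s0).
Proof.
apply/top_ranksP/eqP => [ss0|-> //]; apply/permP => i.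
by rewrite ss0 // ltn_ord.
Qed.

(** The sequential choice: if the continuations after rank [l] have total mass 1, only the factor at
    [l] survives. An item already placed gives an empty sum. *)
Lemma pl_next_sum l v s0 :
  (forall s1, \sum_(s | top_ranks l.+1 s == top_ranks l.+1 s1)
                \prod_(j : 'I_N | (l < j)%N) pl_factor j s = 1) ->
  \sum_(s | (top_ranks l s == top_ranks l s0) && (s v == l))
     \prod_(j : 'I_N | (l <= j)%N) pl_factor j s
  = if (l <= s0 v)%N then w v / tail_mass l s0 else 0.
Proof.
move=> IH; case: leqP => lv; last by rewrite big_pred0 // => s; exact: top_ranks_next_empty.
(* This permutation has the history of [s0] and puts [v] at rank [l], so it represents the longer
   class. *)
rewrite -[RHS]mulr1 -[X in _ = _ * X](IH (s0 * tperm l (s0 v))%g) mulr_sumr.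
have s1v : (s0 * tperm l (s0 v))%g v = l by rewrite permM tpermR.
apply: eq_big => [s|s /andP[/eqP ss0 /eqP sv]].
  by rewrite -(top_ranks_next s s1v) top_ranks_swap.
rewrite (bigD1 l) //= {1}/pl_factor (_ : (s^-1)%g l = v); last by rewrite -sv permK.
rewrite (tail_mass_top_ranks (leqnn l) ss0).
by congr (_ * _); apply: eq_bigl => j; rewrite ltn_neqAle andbC eq_sym.
Qed.

Lemma pl_tail_sum (l : nat) s0 : (l <= N)%N ->
  \sum_(s | top_ranks l s == top_ranks l s0) \prod_(j : 'I_N | (l <= j)%N) pl_factor j s = 1.
Proof.
(* Backward induction, on the number [d] of ranks still to be filled. With none left the class is a
   single permutation and the product is empty; otherwise the probabilities of the next item sum to
   1. *)
move=> lN; rewrite -(subKn lN); move: (N - l)%N (leq_subr l N) => d.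
elim: d s0 => [|d IH] s0 dN.
  rewrite subn0 (eq_bigl _ _ (fun s => top_ranks_all s s0)) big_pred1_eq big_pred0 // => j.
  by rewrite leqNgt ltn_ord.
have lN' : (N - d.+1 < N)%N by rewrite ltn_subrL (leq_trans _ dN).
pose l' := Ordinal lN'; rewrite -[(N - d.+1)%N]/(l' : nat).
rewrite (partition_big (fun s : {perm 'I_N} => (s^-1)%g l') predT) //=.
transitivity (\sum_v (if (l' <= s0 v)%N then w v / tail_mass l' s0 else 0)).
  apply: eq_bigr => v _; rewrite -pl_next_sum => [|s1].
    apply: eq_bigl => s; congr (_ && _).
    by apply/eqP/eqP => <-; rewrite ?permKV ?permK.
  by have := IH s1 (ltnW dN); rewrite /= -subSn // subSS.
 by rewrite -big_mkcond -mulr_suml /= [LHS]divff //; exact: lt0r_neq0 (tail_mass_gt0 l' s0).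
Qed.

(** The factors at ranks below [l] are constant on a history class. *)
Lemma pl_split (l : nat) s0 (P : pred {perm 'I_N}) :
  \sum_(s | (top_ranks l s == top_ranks l s0) && P s) pl_weight s
  = \prod_(j : 'I_N | (j < l)%N) pl_factor j s0 *
    \sum_(s | (top_ranks l s == top_ranks l s0) && P s)
       \prod_(j : 'I_N | (l <= j)%N) pl_factor j s.
Proof.
rewrite mulr_sumr; apply: eq_bigr => s /andP[/eqP ss0 _].
rewrite /pl_weight (bigID (fun j : 'I_N => (j < l)%N)) /=; congr (_ * _).
  by apply: eq_bigr => j jl; exact: pl_factor_top_ranks ss0.
by apply: eq_bigl => j; rewrite -leqNgt.
Qed.

Lemma pl_top_ranks_sum (l : nat) s0 : (l <= N)%N ->
  \sum_(s | top_ranks l s == top_ranks l s0) pl_weight s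
  = \prod_(j : 'I_N | (j < l)%N) pl_factor j s0.
Proof.
move=> lN; rewrite -[RHS]mulr1 -[X in _ = _ * X](pl_tail_sum s0 lN).
have trueE s : (top_ranks l s == top_ranks l s0)
    = (top_ranks l s == top_ranks l s0) && true by rewrite andbT.
by rewrite !(eq_bigl _ _ trueE) (pl_split l s0 xpredT).
Qed.

Lemma pl_weight_ge0 s : 0 <= pl_weight s.
Proof. by apply: prodr_ge0 => j _; exact: pl_factor_ge0. Qed.

Lemma pl_weight_sum : \sum_s pl_weight s = 1.
Proof.
rewrite -(pl_tail_sum 1%g (leq0n N)); apply: eq_bigl => s.
by apply/esym/top_ranksP => i; rewrite !ltn0.
Qed.

(** After the common factors below [l] are split off, the left sum is [w v / tail_mass l s0] or 0,
    and the right one is 1. *)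
Lemma pl_conditional_bound l v y p :
  (forall s, w v / tail_mass l s <= p) -> 0 <= p ->
  \sum_(s | (top_ranks l s == y) && (s v == l)) pl_weight s
  <= p * \sum_(s | top_ranks l s == y) pl_weight s.
Proof.
move=> wp p0; have [s0 /eqP <-|no] := pickP (fun s => top_ranks l s == y); last first.
  by rewrite !big_pred0 ?mulr0 // => s; rewrite no.
rewrite pl_split pl_next_sum; last by move=> s1; exact: pl_tail_sum.
rewrite (pl_top_ranks_sum s0 (ltnW (ltn_ord l))) mulrC ler_wpM2r //.
  by apply: prodr_ge0 => j _; exact: pl_factor_ge0.
by case: ifP.
Qed.
End PlackettLuce.

(** * Empirical distributions *)

Definition empirical (R : realFieldType) (I X : finType) (t : {ffun I -> X}) (x : X) : R :=
  (\sum_i (t i == x)%:R) / #|I|%:R.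

Lemma empirical_ge0 (R : realFieldType) (I X : finType) (t : {ffun I -> X}) x :
  0 <= empirical R t x.
Proof. by rewrite divr_ge0 // sumr_ge0. Qed.

Lemma empirical_mean (R : realFieldType) (I X : finType) (t : {ffun I -> X}) (f : X -> R) :
  \sum_x empirical R t x * f x = (\sum_i f (t i)) / #|I|%:R.
Proof.
under eq_bigr do rewrite /empirical mulrAC mulr_suml.
rewrite -mulr_suml exchange_big /=; congr (_ / _); apply: eq_bigr => i _.
rewrite (bigD1 (t i)) //= eqxx mul1r big1 ?addr0 // => x; rewrite eq_sym => /negPf ->.
by rewrite mul0r.
Qed.

Lemma empirical_sum (R : realFieldType) (I X : finType) (t : {ffun I -> X}) :
  (0 < #|I|)%N -> \sum_x empirical R t x = 1.
Proof.
move=> I0; under eq_bigr do rewrite -[empirical _ _ _]mulr1.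
by rewrite (empirical_mean t (fun=> 1)) sumr_const divff // pnatr_eq0 -lt0n.
Qed.

Lemma empirical_neq0 (R : realFieldType) (I X : finType) (t : {ffun I -> X}) x :
  empirical R t x != 0 -> exists i, t i = x.
Proof.
move=> tx; have [i /eqP <-|no] := pickP (fun i => t i == x); first by exists i.
by move: tx; rewrite /empirical big1 ?mul0r ?eqxx // => i _; rewrite no.
Qed.

(** The failure budget is split in two: the deviation and the collisions each contribute at most
    1/2, the latter strictly less. *)
Lemma signature_sample (R : realFieldType) N K (lam : {perm 'I_N} -> R) (p eps : R) (L : nat) :
  (forall s, 0 <= lam s) -> \sum_s lam s = 1 -> 0 <= p <= 1 -> (L <= N)%N ->
  (forall (l v : 'I_N) y, (l < L)%N ->
     \sum_(s | (top_ranks l s == y) && (s v == l)) lam s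
     <= p * \sum_(s | top_ranks l s == y) lam s) ->
  (0 < K)%N -> 0 < eps -> 2 * N%:R <= K%:R * eps ^+ 2 ->
  K%:R * (1 - (1 - p) ^+ K) ^+ L < 1 / 2 ->
  exists t : {ffun 'I_K -> {perm 'I_N}},
    \sum_i \sum_j ((\sum_s lam s * (s i == j)%:R)
       - (\sum_s empirical R t s * (s i == j)%:R)) ^+ 2 <= eps ^+ 2 /\
    forall k, exists i, forall k', k' != k -> t k' i != t k i.
Proof.
move=> lam0 lam1 p01 LN cond K0 eps0 NK bad.
pose M i j := \sum_s lam s * (s i == j)%:R.
pose g (f : 'I_N * 'I_N) (s : {perm 'I_N}) : R := (s f.1 == f.2)%:R - M f.1 f.2.
have K0' : 0 < K%:R :> R by rewrite ltr0n.
(* Each row of [M] sums to 1. *)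
have Msum : \sum_(f : 'I_N * 'I_N) M f.1 f.2 = N%:R.
  rewrite -(pair_big xpredT xpredT (fun i j => M i j)) /=.
  under eq_bigr do rewrite exchange_big /=.
  rewrite -[in RHS](card_ord N) -sumr_const; apply: eq_bigr => i _.
  rewrite -[RHS]lam1; apply: eq_bigr => s _.
  rewrite -mulr_sumr (bigD1 (s i)) //= eqxx big1 ?addr0 ?mulr1 // => j.
  by rewrite eq_sym => /negPf ->.
have gvar f : \sum_s lam s * g f s ^+ 2 <= M f.1 f.2.
  (* The variance of a Bernoulli variable of mean [M f.1 f.2]. *)
  have : \sum_s lam s * g f s ^+ 2 = M f.1 f.2 - M f.1 f.2 ^+ 2.
    transitivity (\sum_s (lam s * (s f.1 == f.2)%:R * (1 - 2 * M f.1 f.2)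
        + lam s * M f.1 f.2 ^+ 2)).
      by apply: eq_bigr => s _; rewrite /g; case: (_ == _) => /=; ring.
    by rewrite big_split /= -!mulr_suml lam1 -/(M _ _); ring.
  by move=> ->; rewrite gerBl sqr_ge0.
have g0 f : \sum_s lam s * g f s = 0.
  by under eq_bigr do rewrite mulrBr; rewrite sumrB -mulr_suml lam1 mul1r subrr.
(* The threshold is [(K eps)^2] because the deviations are summed over the [K] samples, not
   averaged. *)
have [|||||t [tM tS]] := @iid_good_sample R 'I_K _ _ _ lam g p N%:R ((K%:R * eps) ^+ 2)
    (@top_ranks N) (@agree_at N) L lam0 lam1 p01 _ _ g0.
- move=> s l y lL; have lN := leq_trans lL LN.
  rewrite (eq_bigl (fun x : {perm 'I_N} =>
      (top_ranks l x == y) && (x ((s^-1)%g (Ordinal lN)) == Ordinal lN))).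
    exact: (cond (Ordinal lN)).
  by move=> x; rewrite -agree_atE.
- by move=> s j l x x' jl lL; exact: agree_at_top_ranks.
- by rewrite -Msum; apply: ler_sum => f _; exact: gvar.
- by rewrite exprn_gt0 // mulr_gt0.
- have Kn0 : K%:R != 0 :> R by rewrite gt_eqF.
  have NK2 : K%:R * N%:R / (K%:R * eps) ^+ 2 <= 1 / 2.
    have -> : K%:R * N%:R / (K%:R * eps) ^+ 2 = N%:R / (K%:R * eps ^+ 2).
      by field; rewrite Kn0 gt_eqF.
    by rewrite ler_pdivrMr ?mulr_gt0 ?exprn_gt0 //; lra.
  have [p0 p1] := andP p01.
  have qK : (1 - (1 - p) ^+ K.-1) ^+ L <= (1 - (1 - p) ^+ K) ^+ L.
    have p1' : 0 <= 1 - p <= 1 by apply/andP; split; lra.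
    have [q0 q1] := andP p1'.
    rewrite lerXn2r ?nnegrE ?subr_ge0 ?exprn_ile1 // lerD2l lerN2.
    by rewrite -[in leLHS](prednK K0) exprS ler_piMl ?exprn_ge0.
  have : K%:R * (1 - (1 - p) ^+ K.-1) ^+ L < 1 / 2.
    by apply: le_lt_trans bad; rewrite ler_pM2l.
  by rewrite card_ord; lra.
exists t; split.
  rewrite pair_big /=.
  rewrite (eq_bigr (fun f => (\sum_k g f (t k)) ^+ 2 / K%:R ^+ 2)) => [|[i j] _ /=].
    by rewrite -mulr_suml ler_pdivrMr ?exprn_gt0 // -exprMn mulrC.
  rewrite empirical_mean card_ord /g sumrB sumr_const card_ord -/(M i j) -mulr_natr.
  by field; rewrite gt_eqF.
move=> k; have [j Hj] := tS k; have jN := leq_trans (ltn_ord j) LN.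
(* The witness is the item of [t k] at its collision-free rank [j]. *)
exists (((t k)^-1)%g (Ordinal jN)) => k' /Hj.
by rewrite (agree_atE _ _ (Ordinal jN)) permKV.
Qed.

(** * The two models *)

Lemma MmatE N (lam : {perm 'I_N} -> R) i j :
  Mmat lam i j = \sum_s lam s * (s i == j)%:R.
Proof. by apply: eq_bigr => s _; case: (s i == j). Qed.

Lemma frobE N (A : 'I_N -> 'I_N -> R) : frob A = Num.sqrt (\sum_i \sum_j A i j ^+ 2).
Proof.
rewrite /frob RsqrtE; congr Num.sqrt.
by apply: eq_bigr => i _; apply: eq_bigr => j _; rewrite RpowE.
Qed.

Lemma frob_le N (A : 'I_N -> 'I_N -> R) (e : R) : 0 <= e ->
  (frob A <= e) = (\sum_i \sum_j A i j ^+ 2 <= e ^+ 2).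
Proof.
move=> e0; have S0 : 0 <= \sum_i \sum_j A i j ^+ 2.
  by apply: sumr_ge0 => i _; apply: sumr_ge0 => j _; exact: sqr_ge0.
by rewrite frobE -(@ler_pXn2r _ 2) ?nnegrE ?sqrtr_ge0 // sqr_sqrtr.
Qed.

(** Entrywise [(a + b)^2 <= 2 a^2 + 2 b^2] stands in for the triangle inequality; it loses nothing
    here, as both distances have the same bound [e]. *)
Lemma frob_mdiff_double N (A B C : 'I_N -> 'I_N -> R) (e : R) : 0 <= e ->
  frob (mdiff A B) <= e -> frob (mdiff B C) <= e -> frob (mdiff A C) <= 2 * e.
Proof.
move=> e0; rewrite !frob_le ?mulr_ge0 // => AB BC.
apply: (@le_trans _ _ (2 * (\sum_i \sum_j mdiff A B i j ^+ 2)
    + 2 * (\sum_i \sum_j mdiff B C i j ^+ 2))).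
  rewrite !mulr_sumr -big_split; apply: ler_sum => i _.
  rewrite !mulr_sumr -big_split; apply: ler_sum => j _ /=.
  rewrite /mdiff !RminusE -subr_ge0.
  by have := sqr_ge0 ((A i j - B i j) - (B i j - C i j)); congr (_ <= _); ring.
by rewrite exprMn; lra.
Qed.

Lemma mnlE N (w : 'I_N -> R) s : mnl w s = pl_weight w s.
Proof.
apply: eq_bigr => j _; rewrite RdivE /pl_factor; congr (_ / _).
rewrite /tail_mass [RHS](reindex_inj (@perm_inj _ s^-1%g)).
by apply: eq_bigl => k; rewrite permKV.
Qed.

(** Before rank [l < L] at least [N - L] items remain, so the tail mass is at least the sum of the
    [N - L] smallest weights, while [w v] is at most the largest weight. *)
Lemma mnl_conditional_bound delta N (w : 'I_N -> R) (l v : 'I_N) y :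
  mnl_hyp delta w -> (0 < Lfloor delta N < N)%N -> (l < Lfloor delta N)%N ->
  0 <= sqrt (ln (INR N)) ->
  \sum_(s | (top_ranks l s == y) && (s v == l)) pl_weight w s
  <= sqrt (ln (INR N)) / N%:R * \sum_(s | top_ranks l s == y) pl_weight w s.
Proof.
move=> [w0' [wlt wN]] /andP[L0 LN] lL c0.
have w0 i : 0 < w i by apply/RltP; exact: w0'.
have wle (i j : 'I_N) : (i <= j)%N -> w i <= w j.
  rewrite leq_eqVlt => /orP[/eqP/val_inj -> //|ij]; exact/ltW/RltP/wlt.
apply: pl_conditional_bound => // [s|]; last by rewrite divr_ge0.
have N0 := leq_ltn_trans (leq0n l) (ltn_ord l).
have N1 : (N.-1 < N)%N by rewrite prednK.
have /RleP := wN (Ordinal N1) erefl; rewrite !RdivE INRE; apply: le_trans.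
set m := (X in _ <= _ / X).
have m_tail : m <= tail_mass w l s.
  rewrite /m /tail_mass; apply: (sum_smallest_le (A := fun i => (l <= s i)%N)) => //.
  - by move=> i; exact: ltW.
  - by rewrite ltn_subrL L0.
  - rewrite -sum1_card (reindex_inj (@perm_inj _ s^-1%g)) /=.
    rewrite (eq_bigl (mem [pred k : 'I_N | (l <= k)%N])) => [|k]; last first.
      by rewrite unfold_in /= permKV.
    rewrite sum1_card card_ord_geq; last exact/ltnW/ltn_ord.
    exact/leq_sub2l/ltnW.
have m0 : 0 < m.
  rewrite /m (bigD1 (Ordinal N0)) /= ?subn_gt0 //.
  by apply: ltr_pwDl => //; apply: sumr_ge0 => i _; exact: ltW.
apply: ler_pM => //; [exact: ltW|by rewrite invr_ge0 ltW // tail_mass_gt0| |].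
  by apply: wle; rewrite /= -ltnS prednK.
by rewrite lef_pV2 ?posrE // tail_mass_gt0.
Qed.

Lemma expo_weightE N (theta : 'I_N -> 'I_N -> R) s :
  expo_weight theta s = exp (\sum_i theta i (s i)).
Proof.
congr exp; apply: eq_bigr => i _.
transitivity (\sum_j theta i j * (s i == j)%:R).
  by apply: eq_bigr => j _; rewrite /sig_ind; case: (s i == j).
rewrite (bigD1 (s i)) //= eqxx mulr1 big1 ?addr0 // => j; rewrite eq_sym => /negPf ->.
by rewrite mulr0.
Qed.

(** Only the terms of the items [a], [b] at ranks [j], [k] change, which is the ratio in
    [expfam_hyp]; the four pairs are distinct when [j] and [k] are. For [j = k] the bound is
    [1 <= sqrt (ln N)]. *)
Lemma expo_weight_swap N (theta : 'I_N -> 'I_N -> R) s j k :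
  expfam_hyp theta -> 1 <= sqrt (ln (INR N)) ->
  expo_weight theta s <= sqrt (ln (INR N)) * expo_weight theta (s * tperm j k)%g.
Proof.
move=> hyp c1; have exp_gt0 x : 0 < exp x by apply/RltP; exact: exp_pos.
have [->|jk] := eqVneq j k; first by rewrite tperm1 mulg1 ler_peMl // ltW // exp_gt0.
pose a := (s^-1)%g j; pose b := (s^-1)%g k.
have sa : s a = j by rewrite permKV. have sb : s b = k by rewrite permKV.
have ab : a != b by rewrite (inj_eq perm_inj).
clearbody a b.
have H : exp (theta a j + theta b k) / exp (theta a k + theta b j) <= sqrt (ln (INR N)).
  by apply/RleP; rewrite -RdivE; apply: (hyp (a, j) (b, k) (a, k) (b, j));
    move: jk ab => /eqP jk /eqP ab; congruence.
rewrite !expo_weightE.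
pose rest := \sum_(i | (i != a) && (i != b)) theta i (s i).
have -> : \sum_i theta i (s i) = (theta a j + theta b k) + rest.
  by rewrite (bigD1 a) //= (bigD1 b) 1?eq_sym //= sa sb addrA.
have -> : \sum_i theta i ((s * tperm j k)%g i) = (theta a k + theta b j) + rest.
  rewrite (bigD1 a) //= (bigD1 b) 1?eq_sym //= !permM sa sb tpermL tpermR addrA.
  congr (_ + _); apply: eq_bigr => i /andP[ia ib]; rewrite permM tpermD //.
    by rewrite -sa (inj_eq perm_inj) eq_sym.
  by rewrite -sb (inj_eq perm_inj) eq_sym.
by rewrite -!(expRD _ rest) mulrA ler_pM2r // -ler_pdivrMr.
Qed.

Lemma Zpart_gt0 N (theta : 'I_N -> 'I_N -> R) : 0 < Zpart theta.
Proof.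
have -> : Zpart theta = \sum_s expo_weight theta s by [].
rewrite (bigD1 1%g) //=; apply: ltr_pwDl; first by apply/RltP; exact: exp_pos.
by apply: sumr_ge0 => s _; apply/ltW/RltP; exact: exp_pos.
Qed.

Lemma support_empirical N K (t : {ffun 'I_K -> {perm 'I_N}}) s :
  s \in Defs.support (empirical R t) -> exists k, t k = s.
Proof.
rewrite inE /Rnz; case: RIneq.Req_EM_T => // nz _.
by apply: (@empirical_neq0 R); apply/eqP.
Qed.

Lemma norm0_empirical N K (t : {ffun 'I_K -> {perm 'I_N}}) :
  (norm0 (empirical R t) <= K)%N.
Proof.
rewrite -[X in (_ <= X)%N]card_ord; apply: leq_trans (leq_image_card t predT).
by apply/subset_leq_card/subsetP => s /support_empirical[k <-]; exact: image_f.
Qed.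
Lemma mnl_model delta N (w : 'I_N -> R) (lam : {perm 'I_N} -> R) :
  mnl_hyp delta w -> lam =1 mnl w -> (0 < Lfloor delta N < N)%N -> 0 <= sqrt (ln (INR N)) ->
  [/\ forall s, 0 <= lam s, \sum_s lam s = 1 &
    forall (l v : 'I_N) y, (l < Lfloor delta N)%N ->
      \sum_(s | (top_ranks l s == y) && (s v == l)) lam s
      <= 2 * sqrt (ln (INR N)) / N%:R * \sum_(s | top_ranks l s == y) lam s].
Proof.
move=> hyp lamE LN c0.
have w0 i : 0 < w i by apply/RltP; exact: hyp.1.
have {}lamE s : lam s = pl_weight w s by rewrite lamE mnlE.
split=> [s||l v y lL]; first by rewrite lamE pl_weight_ge0.
  by rewrite (eq_bigr _ (fun s _ => lamE s)) pl_weight_sum.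
rewrite !(eq_bigr _ (fun s _ => lamE s)).
apply: le_trans (mnl_conditional_bound v y hyp LN lL c0) _.
apply: ler_wpM2r; first by apply: sumr_ge0 => s _; exact: pl_weight_ge0.
by rewrite ler_wpM2r ?invr_ge0 //; lra.
Qed.

(** Swapping gives the bound [sqrt (ln N) / (N - l)]; the factor 2 comes from [N - l >= N / 2], as
    [2 L <= N]. *)
Lemma expfam_model L N (theta : 'I_N -> 'I_N -> R) (lam : {perm 'I_N} -> R) :
  expfam_hyp theta -> lam =1 expfam theta -> (2 * L <= N)%N -> 1 <= sqrt (ln (INR N)) ->
  [/\ forall s, 0 <= lam s, \sum_s lam s = 1 &
    forall (l v : 'I_N) y, (l < L)%N ->
      \sum_(s | (top_ranks l s == y) && (s v == l)) lam s
      <= 2 * sqrt (ln (INR N)) / N%:R * \sum_(s | top_ranks l s == y) lam s].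
Proof.
move=> hyp lamE LN c1; have Z0 := Zpart_gt0 theta.
have {}lamE s : lam s = expo_weight theta s / Zpart theta by rewrite lamE /expfam RdivE.
have lam0 s : 0 <= lam s.
  by rewrite lamE divr_ge0 ?ltW //; apply/RltP; exact: exp_pos.
split=> // [|l v y lL].
  rewrite (eq_bigr _ (fun s _ => lamE s)) -mulr_suml.
  by rewrite -[\sum_s expo_weight theta s]/(Zpart theta) divff // gt_eqF.
have N0 : 0 < N%:R :> R by rewrite ltr0n (leq_ltn_trans (leq0n l)).
have c0 : 0 <= sqrt (ln (INR N)) by lra.
have swap s j k : lam s <= sqrt (ln (INR N)) * lam (s * tperm j k)%g.
  by rewrite !lamE mulrA ler_pM2r ?invr_gt0 // expo_weight_swap.
have := swap_conditional_bound l v y lam0 c0 swap.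
set S := \sum_(s | _ && _) _; set T := \sum_(s | _) _ => ST.
have S0 : 0 <= S by apply: sumr_ge0.
have Nl : N%:R <= 2 * (N - l)%:R :> R.
  have : 2 * l%:R <= N%:R :> R.
    by rewrite -natrM ler_nat (leq_trans _ LN) // leq_mul2l ltnW.
  by rewrite natrB; [lra | exact/ltnW/ltn_ord].
have NS : N%:R * S <= 2 * (N - l)%:R * S by rewrite ler_wpM2r.
rewrite mulrAC ler_pdivlMr //.
by rewrite mulrC; apply: le_trans NS _; rewrite -!mulrA ler_pM2l.
Qed.

(** * From a good sample to a sparse signature model *)

Lemma sparse_signature N K (lam : {perm 'I_N} -> R) (p eps : R) (L : nat) :
  (forall s, 0 <= lam s) -> \sum_s lam s = 1 -> 0 <= p <= 1 -> (L <= N)%N ->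
  (forall (l v : 'I_N) y, (l < L)%N ->
     \sum_(s | (top_ranks l s == y) && (s v == l)) lam s
     <= p * \sum_(s | top_ranks l s == y) lam s) ->
  (0 < K)%N -> 0 < eps -> 2 * N%:R <= K%:R * eps ^+ 2 ->
  K%:R * (1 - (1 - p) ^+ K) ^+ L < 1 / 2 ->
  exists lamh : {perm 'I_N} -> R,
    [/\ choice_model lamh, signature_family lamh,
        frob (mdiff (Mmat lam) (Mmat lamh)) <= eps & (norm0 lamh <= K)%N].
Proof.
move=> lam0 lam1 p01 LN cond K0 eps0 NK bad.
have [t [tM tS]] := signature_sample lam0 lam1 p01 LN cond K0 eps0 NK bad.
exists (empirical R t); split.
- split=> [s|]; first by apply/RleP; exact: empirical_ge0.
  by apply: empirical_sum; rewrite card_ord.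
- move=> _ /support_empirical[k <-]; have [i Hi] := tS k.
  exists i, (t k i); split=> // _ /support_empirical[k' <-] kk'.
  (* Different permutations of the support carry different sample indices, so the condition on
     indices applies. *)
  by apply/eqP/Hi/eqP => kE; apply: kk'; rewrite kE.
- rewrite frob_le; last exact: ltW.
  apply: le_trans tM; apply: ler_sum => i _; apply: ler_sum => j _.
  by rewrite /mdiff RminusE !MmatE.
- exact: norm0_empirical.
Qed.

Local Close Scope ring_scope.
Open Scope R_scope.

Theorem theorem3p3 :
  forall (delta eps : R), (0 < delta < 1) -> (0 < eps < 1/2) ->
  exists N0 : nat, forall N : nat, (N0 <= N)%N ->
  forall (D : 'I_N -> 'I_N -> R) (lam : {perm 'I_N} -> R),
    ((exists w : 'I_N -> R, mnl_hyp delta w /\ forall s, lam s = mnl w s) \/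
     (exists theta : 'I_N -> 'I_N -> R,
        expfam_hyp theta /\ forall s, lam s = expfam theta s)) ->
    (frob (mdiff D (Mmat lam)) <= eps) ->
    exists lamh : {perm 'I_N} -> R,
      choice_model lamh /\ signature_family lamh /\
      (frob (mdiff D (Mmat lamh)) <= 2 * eps) /\
      (INR (norm0 lamh) <= 4 * INR N / eps ^ 2).
Proof.
move=> delta eps deltaP epsP; have [N0 HN0] := asymptotics deltaP epsP.
exists N0 => N N0N D lam model Dlam.
have [[L0 LN /RleP c1] [[/RltP p0 /RleP p1] [K [NK KN bad]]]] := HN0 N N0N.
have pE : 2 * sqrt (ln (INR N)) / INR N = (2 * sqrt (ln (INR N)) / N%:R)%R.
  by rewrite RdivE INRE.
have eps0 : (0 < eps)%O by apply/RltP; exact: epsP.1.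
have LltN : (Lfloor delta N < N)%N.
  by apply: leq_trans LN; rewrite mul2n -addnn -addn1 leq_add2l.
have [lam0 lam1 cond] : [/\ forall s, (0 <= lam s)%O, (\sum_s lam s)%R = 1 &
    forall (l v : 'I_N) y, (l < Lfloor delta N)%N ->
      (\sum_(s | (top_ranks l s == y) && (s v == l)) lam s
      <= 2 * sqrt (ln (INR N)) / N%:R * \sum_(s | top_ranks l s == y) lam s)%R].
  case: model => [[w [hyp lamE]]|[theta [hyp lamE]]].
    apply: mnl_model hyp lamE _ _; first by rewrite L0 LltN.
    exact: le_trans ler01 c1.
  exact: expfam_model hyp lamE LN c1.
have K0 : (0 < K)%N.
  rewrite lt0n; apply/eqP => KE; move: NK; rewrite KE [INR 0]/= Rmult_0_l.
  have : 0 < INR N by apply/lt_0_INR/ssrnat.ltP/(leq_ltn_trans _ LltN).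
  move=> N1 N2; apply: (Rlt_irrefl 0); apply: Rlt_le_trans N2.
  by apply: Rmult_lt_0_compat => //; exact: Rlt_0_2.
have [lamh [cm sf frobh normh]] : exists lamh : {perm 'I_N} -> R,
    [/\ choice_model lamh, signature_family lamh,
      (frob (mdiff (Mmat lam) (Mmat lamh)) <= eps)%O & (norm0 lamh <= K)%N].
  apply: (@sparse_signature N K lam _ eps _ lam0 lam1 _ (ltnW LltN) cond K0 eps0).
  - by rewrite -pE ltW.
  - by move/RleP: NK; rewrite RmultE RpowE !INRE.
  - by rewrite -pE; move/RltP: bad; rewrite RmultE !RpowE INRE.
exists lamh; split=> //; split=> //; split.
  (* One [eps] comes from the error in [D], the other from sampling. *)
  by apply/RleP; apply: frob_mdiff_double frobh; [exact: ltW | exact/RleP].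
apply: Rle_trans KN; exact/le_INR/ssrnat.leP.
Qed.
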